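(* The maximum of the deviation rate $\delta(X_T)$ over all compact convex sets $T\subset\mathbb{C}$ (not reduced to a single point) is attained by a $2$-gon; that is, if $U$ is a $2$-gon, then $\delta(X_T)\le\delta(X_U)$ for every compact convex set $T\subset\mathbb{C}$ which is not a single point.
   Context: Let $\Omega=\mathbb{R}/2\pi\mathbb{Z}$ with the normalized Lebesgue (uniform probability) measure, and let $\mathbb{E}$ denote expectation. For a compact convex set $T\subset\mathbb{C}$ and $\omega\in\Omega$, $X_T(\omega)$ is the length of the orthogonal projection of $T$ along the direction $e^{\mathbf{i}\omega}$ (the length of the shadow of $T$ under light from direction $\omega$), i.e. the width of $T$ measured along the direction $\omega+\frac{\pi}{2}$: $X_T(\omega)=\max_{z,w\in T}\langle z-w,\, \mathbf{i}e^{\mathbf{i}\omega}\rangle$, with $\langle\cdot,\cdot\rangle$ the Euclidean inner product on $\mathbb{C}=\mathbb{R}^2$. The deviation rate is $$\delta(X_T)=\frac{\sqrt{\mathbb{E}(X_T^2)-\mathbb{E}(X_T)^2}}{\mathbb{E}(X_T)},$$ which is invariant under similarities of $T$. A $2$-gon is a line segment with two distinct endpoints (all $2$-gons are similar to each other). *)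

(* Defs.v *)
From HB Require Import structures.
From mathcomp Require Import all_boot all_order all_algebra.
From mathcomp Require Import complex.
From mathcomp Require Import all_classical all_reals all_analysis.

Set Implicit Arguments.
Unset Strict Implicit.
Unset Printing Implicit Defensive.

Import Order.TTheory GRing.Theory Num.Theory numFieldNormedType.Exports.
Local Open Scope classical_set_scope.
Local Open Scope complex_scope.
Local Open Scope ring_scope.

Section Shadows.
Variable R : realType.
Implicit Types (T : set R[i]) (X : R -> R) (omega : R).

(* The usual topology of the complex plane is carried by [R[i]^o] and its
   structure of real vector space by [Rcomplex R]; the casts only select these
   structures.  The empty set is excluded explicitly: its shadow has no
   length. *)
Definition nontrivial_convex_body T : Prop :=
  [/\ compact (T : set R[i]^o), convex_set (T : set (Rcomplex R)),
      T !=set0 & forall z, T <> [set z]].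

Definition segment (a b : R[i]) : set R[i] :=
  [set (1 - t)%:C * a + t%:C * b | t in `[0, 1] : set R].

Definition is_two_gon T : Prop := exists a b, a != b /\ T = segment a b.

Definition inner (z w : R[i]) : R :=
  complex.Re z * complex.Re w + complex.Im z * complex.Im w.

Definition cis omega : R[i] := cos omega +i* sin omega.

(* For a nonempty compact [T] the supremum is a maximum. *)
Definition shadow T omega : R :=
  sup [set inner (z - w) ('i * cis omega) | z in T & w in T].

Lemma two_pi_gt0 : 0 < 2 * pi :> R.
Proof. by rewrite mulr_gt0// pi_gt0. Qed.

(* Functions on the circle R / 2 pi Z are represented by 2pi-periodic functions
   on R, and their expectation is taken over one period. *)
Definition circle_prob : probability (measurableTypeR R) R :=
  uniform_prob two_pi_gt0.

Definition mean X : R := fine 'E_circle_prob[X].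

Definition deviation_rate X : R :=
  Num.sqrt (mean (fun omega => X omega ^+ 2) - mean X ^+ 2) / mean X.

End Shadows.

(* Main.v *)
Require Import Defs.
From HB Require Import structures.
From mathcomp Require Import all_boot all_order all_algebra.
From mathcomp Require Import complex.
From mathcomp Require Import all_classical all_reals all_analysis.
From mathcomp Require Import measurable_realfun.
From mathcomp Require Import ring lra.

Import Order.TTheory GRing.Theory Num.Theory numFieldNormedType.Exports.
Local Open Scope classical_set_scope.
Local Open Scope complex_scope.
Local Open Scope ring_scope.

(** The deviation rate of [X] only depends on the ratio of [mean (X^2)] to
    [(mean X)^2], so the claim is that this ratio is largest for a segment.  The
    shadow of a segment is [r * `|sin|] up to a rotation, with mean [2 r / pi]
    and mean square [r^2 / 2]: the ratio is [pi^2 / 8].  For a polygon with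
    edges [e_i] the shadow is half the sum of the shadows of the edges.  In the
    inequality [sqrt (mean (X^2)) <= pi / sqrt 8 * mean X] the left-hand side is
    a norm and the right-hand side is additive, so it passes from the segments
    to their sums.

    A general convex body [T] is not a sum of segments up to central symmetry,
    but a limit of such sums.  Its shadow [w] is a width function: it is
    continuous, nonnegative, invariant under half a turn ([shadow_periodic]) and
    sine-convex ([shadow_sine_convex]).  For a regular grid of [n] directions,
    [w] is at most the width of the polygon circumscribed to [T] with sides in
    these directions, which is an explicit nonnegative combination of translates
    of [`|sin|] ([le_jump_sum]).  The L2 triangle inequality bounds the root
    mean square of [w] by the sum of the coefficients, that is, up to a constant,
    by the sum of the values of [w] on the grid ([mean_sqr_le_grid_sum]).
    Averaging over all rotations of the grid replaces this sum by [n * mean w],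
    and [n] tending to infinity gives the sharp constant ([mean_sqr_le]). *)

(** * Means of continuous functions on the circle *)

Section CircleMean.
Context {R : realType}.
Implicit Types f g F : R -> R.

Lemma mean_integral f : continuous f -> (forall x, 0 <= f x) ->
  (mean f)%:E = ((2 * pi)^-1%:E *
    \int[lebesgue_measure]_(x in `[0%R, (2 * pi)%R]) (f x)%:E)%E.
Proof.
move=> cf f0.
have mf : measurable_fun setT f by exact: continuous_measurable_fun.
have E : ('E_(circle_prob R)[f] = (2 * pi)^-1%:E *
    \int[lebesgue_measure]_(x in `[0%R, (2 * pi)%R]) (f x)%:E)%E.
  rewrite unlock integral_uniform ?subr0//.
  exact/measurable_EFinP.
rewrite /mean E fineK// fin_numM//.
apply: integrable_fin_num => //; apply: continuous_compact_integrable => //.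
  exact: segment_compact.
exact: continuous_subspaceT.
Qed.

(** The integral function of [f] has a base point, and is differentiable only
    to the right of it; [c] lets that point be as far to the left as needed. *)
Lemma antiderivative_exists f (c : R) : continuous f ->
  exists F, forall x : R, c < x -> is_derive x 1 F (f x).
Proof.
move=> cf; exists (fun x => \int[lebesgue_measure]_(t in `[c, x]) f t) => x cx.
have xx1 : x < x + 1 by rewrite ltrDl.
have fi : lebesgue_measure.-integrable `[c, x + 1] (EFin \o f).
  apply: continuous_compact_integrable; first exact: segment_compact.
  exact: continuous_subspaceT.
have [dF F'] := @continuous_FTC1_closed R f c x (x + 1) xx1 fi cx (cf x).
by apply: DeriveDef; rewrite // -derive1E.
Qed.

(** All the means below are computed through this form of the fundamental
    theorem of calculus.  The bound [-1] is any number below the period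
    [[0, 2 pi]], so that [F] is differentiable at the end points too. *)
Lemma mean_antiderivative f F : continuous f -> (forall x, 0 <= f x) ->
  (forall x : R, -1 < x -> is_derive x 1 F (f x)) ->
  mean f = (F (2 * pi) - F 0) / (2 * pi).
Proof.
move=> cf f0 dF; apply: EFin_inj; rewrite mean_integral//.
have pi2 : 0 < 2 * pi :> R by exact: two_pi_gt0.
have cF (x : R) : -1 < x -> {for x, continuous F}.
  move=> /dF dFx; apply/differentiable_continuous/derivable1_diffP.
  exact: ex_derive.
rewrite (@continuous_FTC2 _ f F)//.
- by rewrite -EFinB -EFinM mulrC.
- exact: continuous_subspaceT.
- split.
  + move=> x; rewrite in_itv/= => /andP[x0 _]; apply: ex_derive.
    by apply: dF; lra.
  + by apply: cvg_at_right_filter; apply: cF; lra.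
  + by apply: cvg_at_left_filter; apply: cF; lra.
- move=> x; rewrite in_itv/= => /andP[x0 _]; rewrite derive1E.
  by apply: derive_val; apply: dF; lra.
Qed.

Lemma mean_ge0 f : (forall x, 0 <= f x) -> 0 <= mean f.
Proof. by move=> f0; apply: fine_ge0; exact: expectation_ge0. Qed.

Lemma mean_le f g : continuous f -> continuous g -> (forall x, 0 <= f x) ->
  (forall x, f x <= g x) -> mean f <= mean g.
Proof.
move=> cf cg f0 fg; rewrite -lee_fin !mean_integral//; last first.
  by move=> x; exact: le_trans (fg x).
apply: lee_pmul => //.
- by rewrite lee_fin invr_ge0 ltW ?two_pi_gt0.
- by apply: integral_ge0 => x _; rewrite lee_fin.
apply: ge0_le_integral => //=.
- by move=> x _; rewrite lee_fin.
- apply/measurable_EFinP; apply: measurable_funTS.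
  exact: continuous_measurable_fun.
- apply/measurable_EFinP; apply: measurable_funTS.
  exact: continuous_measurable_fun.
- by move=> x _; rewrite lee_fin.
Qed.

Lemma continuous_lincomb (I : Type) (r : seq I) (c : I -> R) (f : I -> R -> R) :
  (forall i, continuous (f i)) -> continuous (fun x => \sum_(i <- r) c i * f i x).
Proof.
move=> cf; elim: r => [|i r IH].
  under eq_fun do rewrite big_nil; exact: cst_continuous.
under eq_fun do rewrite big_cons.
by move=> x; apply: cvgD; [apply: cvgM; [exact: cvg_cst|exact: cf]|exact: IH].
Qed.

Lemma continuous_translate f a : continuous f -> continuous (fun x => f (x + a)).
Proof.
move=> cf x; apply: continuous_comp; last exact: cf.
by apply: cvgD; [exact: cvg_id|exact: cvg_cst].
Qed.

Lemma mean_sum (I : Type) (r : seq I) (c : I -> R) (f : I -> R -> R) :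
  (forall i, continuous (f i)) -> (forall i x, 0 <= f i x) ->
  (forall i, 0 <= c i) ->
  mean (fun x => \sum_(i <- r) c i * f i x) = \sum_(i <- r) c i * mean (f i).
Proof.
move=> cf f0 c0.
have /choice[F dF] : forall i, exists F, forall x : R, -1 < x -> is_derive x 1 F (f i x).
  by move=> i; exact: antiderivative_exists.
have cS := continuous_lincomb I r c f cf.
have S0 x : 0 <= \sum_(i <- r) c i * f i x.
  by apply: sumr_ge0 => i _; exact: mulr_ge0.
have dS (x : R) : -1 < x -> is_derive x 1 (fun x => \sum_(i <- r) c i * F i x)
    (\sum_(i <- r) c i * f i x).
  move=> x1; elim: r {cS S0} => [|i r IH].
    under eq_fun do rewrite big_nil; rewrite big_nil; exact: is_derive_cst.
  under eq_fun do rewrite big_cons; rewrite big_cons.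
  apply: is_deriveD; apply: (@is_deriveZ _ _ _ _ (c i)).
  exact: dF.
rewrite (mean_antiderivative _ _ cS S0 dS).
under [RHS]eq_bigr => i _ do
  rewrite (mean_antiderivative _ _ (cf i) (f0 i) (dF i)) mulrA mulrBr.
by rewrite -mulr_suml -sumrB.
Qed.

Lemma eq_of_derive0 (f : R -> R) (a b : R) : a <= b ->
  (forall x : R, a <= x -> x <= b -> is_derive x 1 f 0) -> f a = f b.
Proof.
move=> ab df.
have dab x : x \in `]a, b[ -> is_derive x 1 f (cst 0 x).
  by rewrite in_itv/= => /andP[/ltW ax /ltW xb]; exact: df.
have cf : {within `[a, b], continuous f}.
  apply: continuous_in_subspaceT => x; rewrite inE/= in_itv/= => /andP[ax xb].
  apply/differentiable_continuous/derivable1_diffP.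
  by have := df _ ax xb => ?; exact: ex_derive.
have [x _] := MVT_segment ab dab cf.
by rewrite mul0r => /eqP; rewrite subr_eq0 => /eqP.
Qed.

(** For an antiderivative [F] of a periodic [f], the increment of [F] over a
    period starting at [x] has derivative [f (x + 2 pi) - f x = 0] in [x]. *)
Lemma mean_shift f a : continuous f -> (forall x, 0 <= f x) ->
  periodic f (2 * pi) -> mean (fun x => f (x + a)) = mean f.
Proof.
move=> cf f0 pf.
pose c := - `|a| - 2.
have [F dF] := antiderivative_exists f c cf.
have pi2 : 0 < 2 * pi :> R by exact: two_pi_gt0.
have aN : - `|a| <= a by rewrite lerNl -normrN ler_norm.
have a0 := normr_ge0 a.
have sF (b x : R) : c < x + b -> is_derive x 1 (fun y => F (y + b)) (f (x + b)).
  move=> h; have dFx := dF _ h.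
  have dsh : is_derive x 1 (fun y => y + b) 1.
    by rewrite -[X in is_derive _ _ _ X]addr0; apply: is_deriveD.
  by have := @is_derive1_comp R F (fun y => y + b) x _ _ dFx dsh; rewrite mulr1.
have cfa := continuous_translate f a cf.
have dFa (x : R) : -1 < x -> is_derive x 1 (fun y => F (y + a)) (f (x + a)).
  by move=> x1; apply: sF; rewrite /c; lra.
have dF' (x : R) : -1 < x -> is_derive x 1 F (f x).
  by move=> x1; apply: dF; rewrite /c; lra.
rewrite (mean_antiderivative _ _ cfa (fun x => f0 _) dFa).
rewrite (mean_antiderivative _ _ cf f0 dF').
pose g x := F (x + 2 * pi) - F x.
have dg (x : R) : c < x -> is_derive x 1 g 0.
  move=> cx; rewrite -(subrr (f x)) -{1}(pf x).
  apply: is_deriveB; last exact: dF.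
  by apply: sF; lra.
have g0a : g 0 = g a.
  have c0 : c < 0 by rewrite /c; lra.
  have ca : c < a by rewrite /c; lra.
  by case: (leP 0 a) => [|/ltW] h; [|symmetry]; apply: eq_of_derive0 => // x hx _;
    apply: dg; lra.
by move: g0a; rewrite /g !add0r (addrC a) => ->.
Qed.
End CircleMean.

(** * Sine-convex functions and regular grids *)

Section Grid.
Context {R : realType}.
Implicit Types (w P : R -> R) (n : nat) (phi t u e : R).

(** The positively homogeneous extension of [w] to the plane is convex exactly
    when the graph of [w] lies below the sinusoid through any two of its points
    less than [pi] apart: [w] is then a support function. *)
Definition sine_convex w := forall a b t, a <= t -> t <= b -> b - a <= pi ->
  sin (b - a) * w t <= sin (b - t) * w a + sin (t - a) * w b.

Definition grid n phi (k : nat) : R := phi + k%:R * (pi / n%:R).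

Lemma grid_step_bounds n : (1 < n)%N -> 0 < pi / n%:R :> R /\ pi / n%:R <= pi / 2 :> R.
Proof.
move=> n1; have nr : 2 <= n%:R :> R by rewrite ler_nat.
have n0 : 0 < n%:R :> R by lra.
split; first by rewrite divr_gt0 ?pi_gt0.
by rewrite ler_pM2l ?pi_gt0// lef_pV2// posrE.
Qed.

(** Moving a regular grid by one step only replaces its first point by that
    point plus a period. *)
Lemma grid_sum_shift n P phi : (0 < n)%N -> periodic P pi ->
  \sum_(k < n) P (grid n phi k + pi / n%:R) = \sum_(k < n) P (grid n phi k).
Proof.
case: n => // n _ perP.
have E (k : nat) : grid n.+1 phi k + pi / n.+1%:R = grid n.+1 phi k.+1.
  by rewrite /grid -(natr1 k); set e := pi / _; ring.
under eq_bigr => k _ do rewrite E.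
rewrite big_ord_recr big_ord_recl/= addrC; congr (_ + _).
rewrite /grid mul0r addr0 -[RHS]perP; congr (P (phi + _)).
by rewrite mulrC divfK// pnatr_eq0.
Qed.

Lemma grid_shift n phi e (k : nat) : grid n (phi + e) k = grid n phi k + e.
Proof. by rewrite /grid addrAC. Qed.

Lemma grid_sum_shiftz n P phi (j : int) : (0 < n)%N -> periodic P pi ->
  \sum_(k < n) P (grid n (phi + j%:~R * (pi / n%:R)) k) =
  \sum_(k < n) P (grid n phi k).
Proof.
move=> n0 perP.
have S psi : \sum_(k < n) P (grid n (psi + pi / n%:R) k) = \sum_(k < n) P (grid n psi k).
  by under eq_bigr => k _ do rewrite grid_shift; exact: grid_sum_shift.
have N (m : nat) psi : \sum_(k < n) P (grid n (psi + m%:R * (pi / n%:R)) k) =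
    \sum_(k < n) P (grid n psi k).
  elim: m => [|m IH]; first by rewrite mul0r addr0.
  by rewrite -natr1 mulrDl mul1r addrA S.
case: j => m; first exact: N.
by rewrite -(N m.+1) NegzE mulrNz mulNr subrK.
Qed.

(** [`|sin|] is the width function of a segment; this is its sine-convexity at
    the middle of an interval. *)
Lemma abs_sin_midpoint u e :
  2 * cos e * `|sin u| <= `|sin (u + e)| + `|sin (u - e)|.
Proof.
apply: le_trans (ler_normD _ _); rewrite sinD sinB.
rewrite (_ : _ + _ + _ = 2 * cos e * sin u); last by ring.
by rewrite normrM ler_wpM2r// ler_norm.
Qed.

(** Near the zero of [`|sin|] the preceding lower bound is not sharp: the kink
    contributes a second one. *)
Lemma abs_sin_kink u e :
  2 * sin e * cos u <= `|sin (u + e)| + `|sin (u - e)|.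
Proof.
apply: le_trans (ler_normB _ _); rewrite sinD sinB.
rewrite (_ : _ + _ - _ = 2 * sin e * cos u); last by ring.
exact: ler_norm.
Qed.

(** Divided by [sin e], this is the jump at [x] of the derivative of the function
    that interpolates [w] by sinusoids between the points [x - e], [x] and
    [x + e]. *)
Definition jump w e x := w (x - e) + w (x + e) - 2 * cos e * w x.

(** Sine-convexity at the middle of [[x - e, x + e]], divided by [sin e]. *)
Lemma jump_ge0 w e x : sine_convex w -> 0 < e -> e <= pi / 2 -> 0 <= jump w e x.
Proof.
move=> cw e0 epi.
have se : 0 < sin e by apply: sin_gt0_pi; have := @pi_gt0 R; lra.
have := cw (x - e) (x + e) x.
rewrite (_ : x + e - (x - e) = e *+ 2); last by ring.
rewrite (_ : x + e - x = e); last by ring.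
rewrite (_ : x - (x - e) = e); last by ring.
move=> H; have {H} : sin (e *+ 2) * w x <= sin e * w (x - e) + sin e * w (x + e).
  by apply: H; lra.
rewrite sin_mulr2n -mulrDr => H; rewrite /jump -(pmulr_rge0 _ se).
by rewrite mulrBr subr_ge0; apply: le_trans H; rewrite mulr2n; lra.
Qed.

Lemma sum_jump n w phi : (0 < n)%N -> periodic w pi ->
  \sum_(k < n) jump w (pi / n%:R) (grid n phi k) =
  2 * (1 - cos (pi / n%:R)) * \sum_(k < n) w (grid n phi k).
Proof.
move=> n0 pw; rewrite !big_split/= sumrN -mulr_sumr.
set e := pi / n%:R.
have pwe : periodic (fun x => w (x - e)) pi by move=> x /=; rewrite addrAC pw.
have := grid_sum_shift n _ phi n0 pwe; rewrite -/e /= => <-.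
under eq_bigr => k _ do rewrite addrK.
by have := grid_sum_shift n _ phi n0 pw; rewrite -/e => ->; ring.
Qed.

(** Divided by [2 * sin (pi / n)], the right-hand side is the width function of
    the polygon with sides parallel to the directions of the grid which is
    circumscribed to the centrally symmetric body of width [w]: it interpolates
    [w] by sinusoids between the points of the grid.  The jumps, divided by the
    same factor, are the lengths of the sides, and the sum decomposes the polygon
    into segments.

    A summation by parts moves the second difference from [w] to [`|sin|], where
    it is nonnegative and concentrated at the two grid points around [t]. *)
Lemma le_jump_sum n w phi t : (1 < n)%N -> periodic w pi -> (forall x, 0 <= w x) ->
  sine_convex w ->
  2 * sin (pi / n%:R) * w t <=
  \sum_(k < n) jump w (pi / n%:R) (grid n phi k) * `|sin (t - grid n phi k)|.
Proof.
move=> n1 pw w0 cw; have n0 : (0 < n)%N by exact: ltnW.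
set e := pi / n%:R.
have [e0 epi] : 0 < e /\ e <= pi / 2 := grid_step_bounds n n1.
pose s (x : R) : R := `|sin (t - x)|.
have ps : periodic s pi.
  move=> x; rewrite /s opprD addrA -[LHS]normrN -sinDpi subrK//.
have sB x : `|sin (t - x + e)| = s (x - e) by rewrite /s opprB addrA addrAC.
have sD x : `|sin (t - x - e)| = s (x + e) by rewrite /s opprD addrA.
(* [Q] is the summand after the summation by parts. *)
pose Q x := w x * (s (x + e) + s (x - e) - 2 * cos e * s x).
have pQ : periodic Q pi.
  by move=> x; rewrite /Q (addrAC x pi e) (addrAC x pi (- e)) !ps pw.
have Q0 x : 0 <= Q x.
  apply: mulr_ge0 => //; rewrite subr_ge0.
  have := abs_sin_midpoint (t - x) e.
  by rewrite sB sD (addrC (s (x - e))).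
have -> : \sum_(k < n) jump w e (grid n phi k) * s (grid n phi k) =
    \sum_(k < n) Q (grid n phi k).
  pose P1 x := w (x - e) * s x; pose P2 x := w x * s (x - e).
  have pP1 : periodic P1 pi by move=> x; rewrite /P1 ps addrAC pw.
  have pP2 : periodic P2 pi by move=> x; rewrite /P2 pw addrAC ps.
  have E1 := @grid_sum_shift n P1 phi n0 pP1.
  have E2 := @grid_sum_shift n P2 phi n0 pP2.
  have J x : jump w e x * s x = P1 x + P2 (x + e) - 2 * cos e * (w x * s x).
    by rewrite /P1 /P2 /jump addrK; ring.
  have QE x : Q x = P1 (x + e) + P2 x - 2 * cos e * (w x * s x).
    by rewrite /P1 /P2 /Q addrK; ring.
  under eq_bigr => k _ do rewrite J.
  under [RHS]eq_bigr => k _ do rewrite QE.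
  by rewrite !big_split/= E1 E2.
(* The sum of [Q] does not change when the grid is moved by whole steps, so that
   [t] may be assumed to lie between the first two points [psi] and [psi + e]. *)
pose psi := phi + (Num.floor ((t - phi) / e))%:~R * e.
have [psit tpsi] : psi <= t /\ t <= psi + e.
  have := floor_itv ((t - phi) / e).
  rewrite intrD mulr1z /psi; set m := _%:~R; move=> /andP[fl /ltW fu].
  move: fl fu; rewrite ler_pdivlMr// ler_pdivrMr// mulrDl mul1r => *; split; lra.
rewrite -(grid_sum_shiftz _ _ _ (Num.floor ((t - phi) / e)) n0 pQ) -/e -/psi.
have : Q psi + Q (psi + e) <= \sum_(k < n) Q (grid n psi k).
  rewrite -(subnK n1) addn2 !big_ord_recl/= addrA /grid -addn2 subnK//.
  rewrite mul0r addr0 mul1r -/e lerDl; exact: sumr_ge0.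
apply: le_trans.
have K1 : 2 * sin e * cos (t - psi) <= s (psi + e) + s (psi - e).
  have := abs_sin_kink (t - psi) e.
  by rewrite sB sD (addrC (s (psi - e))).
have K2 : 2 * sin e * cos (t - (psi + e)) <= s (psi + e + e) + s (psi + e - e).
  have := abs_sin_kink (t - (psi + e)) e.
  by rewrite sB sD (addrC (s (psi + e - e))).
have pi0 := @pi_gt0 R.
have su : 0 <= sin (t - psi) by apply: sin_ge0_pi; lra.
have sv : 0 <= sin (psi + e - t) by apply: sin_ge0_pi; lra.
have Q1 : w psi * (2 * sin (psi + e - t)) <= Q psi.
  apply: ler_wpM2l => //; rewrite (ger0_norm su : s psi = _).
  rewrite (_ : psi + e - t = e - (t - psi)); last by ring.
  by rewrite (sinB e); move: K1; lra.
have Q2 : w (psi + e) * (2 * sin (t - psi)) <= Q (psi + e).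
  have -> : Q (psi + e) = w (psi + e) * (s (psi + e + e) + s (psi + e - e) -
      2 * cos e * sin (psi + e - t)).
    by rewrite /Q (_ : s (psi + e) = sin (psi + e - t))// /s -opprB sinN normrN ger0_norm.
  apply: ler_wpM2l => //.
  rewrite (_ : t - psi = e - (psi + e - t)); last by ring.
  by rewrite (sinB e) -[cos (psi + e - t)]cosN opprB; move: K2; lra.
have := cw psi (psi + e) t psit tpsi.
rewrite (_ : psi + e - psi = e); last by ring.
by move=> H; have {H} := H ltac:(lra); lra.
Qed.
End Grid.

(** * The mean square of a sine-convex function *)

Section MeanSquare.
Context {R : realType}.
Implicit Types (w : R -> R) (p q : R).

(** The difference of the two sides is half of the double sum of the terms
    [a i * a j * (s i - s j) ^+ 2]. *)
Lemma sum_cauchy_schwarz n (a s : 'I_n -> R) : (forall k, 0 <= a k) ->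
  (\sum_k a k * s k) ^+ 2 <= (\sum_k a k) * \sum_k a k * s k ^+ 2.
Proof.
move=> a0; rewrite -subr_ge0.
have : 0 <= \sum_i \sum_j a i * a j * (s i - s j) ^+ 2.
  apply: sumr_ge0 => i _; apply: sumr_ge0 => j _.
  exact: mulr_ge0 (mulr_ge0 (a0 i) (a0 j)) (sqr_ge0 _).
have E i j : a i * a j * (s i - s j) ^+ 2 = a i * s i ^+ 2 * a j +
    a i * (a j * s j ^+ 2) - 2 * (a i * s i) * (a j * s j) by ring.
under eq_bigr => i _ do under eq_bigr => j _ do rewrite E.
under eq_bigr => i _ do rewrite !big_split/= sumrN -!mulr_sumr.
rewrite !big_split/= sumrN -!mulr_suml -!mulr_sumr.
by lra.
Qed.

Lemma continuous_trig p q : continuous (fun x : R => p * cos x + q * sin x).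
Proof.
move=> x; apply: cvgD; apply: cvgM; try exact: cvg_cst.
  exact: continuous_cos.
exact: continuous_sin.
Qed.

Lemma continuous_sqr w : continuous w -> continuous (fun x => w x ^+ 2).
Proof. by move=> cw x; exact: (continuous_comp (cw x) (@exprn_continuous R 2 (w x))). Qed.

Lemma mean_sqr_trig p q :
  mean (fun x => (p * cos x + q * sin x) ^+ 2) = (p ^+ 2 + q ^+ 2) / 2.
Proof.
pose F (x : R) := (p ^+ 2 + q ^+ 2) / 2 * x +
  ((p ^+ 2 - q ^+ 2) / 2 * (sin x * cos x) + p * q * (sin x ^+ 2)).
have dF (x : R) : -1 < x -> is_derive x 1 F ((p * cos x + q * sin x) ^+ 2).
  move=> _; rewrite /F; apply: is_derive_eq.
  rewrite /GRing.scale/=.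
  have := cos2Dsin2 x; set c := cos x; set s := sin x.
  by move=> E; rewrite -[X in _ / 2 * X]E; field.
have cT : continuous (fun x => (p * cos x + q * sin x) ^+ 2).
  by apply: continuous_sqr; exact: continuous_trig.
rewrite (mean_antiderivative _ _ cT (fun x => sqr_ge0 _) dF) /F.
have -> : sin (2 * pi) = 0 :> R by rewrite mulr_natl sin2pi.
rewrite sin0 !mul0r expr0n/= !mulr0 !addr0 subr0.
by rewrite mulfK// gt_eqF// two_pi_gt0.
Qed.

Lemma mean_sqr_sin_shift (t : R) : mean (fun x : R => sin (x - t) ^+ 2) = 2^-1.
Proof.
transitivity (mean (fun x : R => (- sin t * cos x + cos t * sin x) ^+ 2)).
  by congr mean; apply/funext => x; rewrite sinB; congr (_ ^+ 2); ring.
by rewrite mean_sqr_trig sqrrN addrC cos2Dsin2 div1r.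
Qed.

Lemma sin_le_id (x : R) : 0 <= x -> sin x <= x.
Proof.
move=> x0.
have dxy z : z \in `]0, x[ -> is_derive z 1 (@sin R) (cos z) by move=> _; exact: is_derive_sin.
have cg : {within `[0, x], continuous (@sin R)}.
  by apply: continuous_subspaceT => z; exact: continuous_sin.
have [z _] := MVT_segment x0 dxy cg.
rewrite sin0 !subr0 => ->.
by rewrite -[leRHS]mul1r ler_wpM2r// cos_le1.
Qed.

Lemma mean_cst c : 0 <= c -> mean (cst c : R -> R) = c.
Proof.
move=> c0; have dF (x : R) : -1 < x -> is_derive x 1 ( *%R c) c.
  by move=> _; apply: is_derive_eq; rewrite /GRing.scale/= mulr1.
rewrite (mean_antiderivative _ _ (@cst_continuous _ _ c) (fun=> c0) dF).
by rewrite mulr0 subr0 mulfK// gt_eqF// two_pi_gt0.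
Qed.

Section Bound.
Context (w : R -> R).
Context (ctsw : continuous w) (w0 : forall x, 0 <= w x)
  (pw : periodic w pi) (cw : sine_convex w).

(** Write the bound of [le_jump_sum] as [2 * sin e * w <= \sum_k J k * s k],
    where every [s k] is a translate of [`|sin|], of mean square 1/2.  The
    triangle inequality in L2 then yields
    [2 * sin e * sqrt (mean w^2) <= (\sum_k J k) / sqrt 2], and the sum of the
    jumps is known from [sum_jump].  Weighting the Cauchy-Schwarz inequality by
    the [J k] replaces the triangle inequality and only uses the mean squares of
    the [s k]. *)
Lemma mean_sqr_le_grid_sum n phi : (1 < n)%N ->
  sin (pi / n%:R) * Num.sqrt (2 * mean (fun x => w x ^+ 2)) <=
  (1 - cos (pi / n%:R)) * \sum_(k < n) w (grid n phi k).
Proof.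
move=> n1; have n0 : (0 < n)%N by exact: ltnW.
set e := pi / n%:R.
have [e0 epi] : 0 < e /\ e <= pi / 2 := grid_step_bounds n n1.
have se : 0 < sin e by apply: sin_gt0_pi; have := @pi_gt0 R; lra.
pose J (k : 'I_n) := jump w e (grid n phi k).
pose S := \sum_(k < n) J k.
have J0 k : 0 <= J k by exact: jump_ge0.
have S0 : 0 <= S by exact: sumr_ge0.
pose f (k : 'I_n) x := sin (x - grid n phi k) ^+ 2.
have cf k : continuous (f k).
  apply: continuous_sqr => x; apply: continuous_comp; last exact: continuous_sin.
  by apply: cvgB; [exact: cvg_id|exact: cvg_cst].
have f0 k x : 0 <= f k x by exact: sqr_ge0.
pose c k := S * J k / (4 * sin e ^+ 2).
have se2 : 0 < 4 * sin e ^+ 2 by rewrite mulr_gt0// exprn_gt0.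
have c0 k : 0 <= c k by rewrite /c divr_ge0 ?mulr_ge0// ltW.
have wle x : w x ^+ 2 <= \sum_k c k * f k x.
  have -> : \sum_k c k * f k x =
      S * (\sum_k J k * `|sin (x - grid n phi k)| ^+ 2) / (4 * sin e ^+ 2).
    rewrite mulr_sumr mulr_suml; apply: eq_bigr => k _.
    by rewrite /c /f real_normK ?num_real//; ring.
  rewrite ler_pdivlMr//.
  have := le_jump_sum n w phi x n1 pw w0 cw; rewrite -/e => H.
  apply: le_trans (sum_cauchy_schwarz _ _ _ J0).
  have -> : w x ^+ 2 * (4 * sin e ^+ 2) = (2 * sin e * w x) ^+ 2 by ring.
  rewrite ler_sqr ?nnegrE//; first by rewrite !mulr_ge0// ltW.
  by apply: le_trans H; rewrite !mulr_ge0// ltW.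
have M : mean (fun x => w x ^+ 2) <= \sum_k c k * mean (f k).
  rewrite -mean_sum//; apply: mean_le => //.
  - exact: continuous_sqr.
  - exact: continuous_lincomb.
  - by move=> x; exact: sqr_ge0.
have {}M : 2 * mean (fun x => w x ^+ 2) <= (S / (2 * sin e)) ^+ 2.
  have -> : (S / (2 * sin e)) ^+ 2 = 2 * \sum_k c k * mean (f k).
    under eq_bigr => k _ do rewrite mean_sqr_sin_shift.
    rewrite -!mulr_suml -mulr_sumr -/S; field.
    by rewrite gt_eqF.
  by rewrite ler_pM2l.
have SE : S = 2 * (1 - cos e) * \sum_(k < n) w (grid n phi k).
  exact: sum_jump.
rewrite mulrC -ler_pdivlMr//.
rewrite (_ : _ / _ = S / (2 * sin e)); last first.
  by rewrite SE; field; rewrite gt_eqF.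
rewrite -[leRHS]ger0_norm ?divr_ge0 ?mulr_ge0 ?(ltW se)//.
by rewrite -sqrtr_sqr ler_wsqrtr.
Qed.

(** The bound [mean_sqr_le_grid_sum] holds for every position [phi] of the grid.
    Averaging over [phi] turns the sum over the grid into [n] times the mean of
    [w], and with [h = pi / (2 * n)] it becomes
    [cos h * sqrt (2 * mean w^2) <= n * sin h * mean w].  Since [n * sin h] is
    at most [pi / 2], the constant appears as [h] tends to 0. *)
Theorem mean_sqr_le : mean (fun x => w x ^+ 2) <= pi ^+ 2 / 8 * mean w ^+ 2.
Proof.
set m := mean _; set M := mean w.
have p0 := @pi_gt0 R.
have M0 : 0 <= M by exact: mean_ge0.
have m0 : 0 <= m by apply: mean_ge0 => x; exact: sqr_ge0.
have pw2 : periodic w (2 * pi) by move=> x; rewrite mulr_natl mulr2n addrA !pw.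
(* The grid has at least two points, so that its step [2 * h] is at most
   [pi / 2]. *)
have key n : cos (pi / 2 / n.+2%:R) * Num.sqrt (2 * m) <= pi / 2 * M.
  set h := pi / 2 / n.+2%:R.
  have n0 : 0 < n.+2%:R :> R by rewrite ltr0n.
  have nr : 2 <= n.+2%:R :> R by rewrite ler_nat.
  have h0 : 0 < h by rewrite !divr_gt0.
  have hn : h * n.+2%:R = pi / 2 by rewrite divfK// gt_eqF.
  have hpi : h <= pi / 4 by rewrite -(ler_pM2r n0) hn; nra.
  have sh : 0 < sin h by apply: sin_gt0_pi; lra.
  have eh : pi / n.+2%:R = h *+ 2 by rewrite mulr2n -mulrDl -splitr.
  have H phi : cos h * Num.sqrt (2 * m) <= \sum_(k < n.+2) sin h * w (phi + k%:R * (h *+ 2)).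
    have := mean_sqr_le_grid_sum n.+2 phi isT.
    rewrite /grid eh sin_mulr2n cos_mulr2n -/m cos2sin2 => H.
    rewrite -mulr_sumr -(ler_pM2l (_ : 0 < 2 * sin h)); last lra.
    by apply: le_trans (le_trans _ H) _; rewrite !mulr2n; [|]; lra.
  have := @mean_le R (cst (cos h * Num.sqrt (2 * m))) 
    (fun x => \sum_(k < n.+2) sin h * w (x + k%:R * (h *+ 2)))
    (@cst_continuous _ _ _) (@continuous_lincomb R _ _ _ _
       (fun k : 'I_n.+2 => continuous_translate _ (k%:R * (h *+ 2)) ctsw)) _ H.
  rewrite mean_cst ?mulr_ge0 ?sqrtr_ge0 ?cos_ge0_pihalf//; try lra.
  rewrite mean_sum//; last 2 first.
  - by move=> k; exact: continuous_translate.
  - by move=> _; exact: ltW.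
  under eq_bigr => k _ do rewrite mean_shift//.
  rewrite sumr_const card_ord -/M => {}H.
  have {}H := H (fun=> ltac:(by rewrite mulr_ge0 ?sqrtr_ge0 ?cos_ge0_pihalf//; lra)).
  apply: le_trans H _.
  rewrite -hn -[leLHS]mulr_natr [leRHS]mulrAC !ler_wpM2r ?ler0n//.
  by apply: sin_le_id; exact: ltW.
have lim : (cos (pi / 2 / n.+2%:R) * Num.sqrt (2 * m)) @[n --> \oo] -->
    Num.sqrt (2 * m).
  have hc : (pi / 2 / n.+2%:R : R) @[n --> \oo] --> (0 : R).
    rewrite -[X in _ --> X](mulr0 (pi / 2)); apply: cvgM; first exact: cvg_cst.
    have := @cvg_harmonic R.
    by rewrite -cvg_shiftS.
  have := cvg_comp _ _ hc (@continuous_cos R 0); rewrite cos0 => hcos.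
  rewrite -[X in _ --> X]mul1r; apply: cvgM; last exact: cvg_cst.
  exact: hcos.
have {key lim} key : Num.sqrt (2 * m) <= pi / 2 * M.
  by apply: (ler_cvg_to lim (cvg_cst (pi / 2 * M))); exact: nearW.
have : Num.sqrt (2 * m) ^+ 2 <= (pi / 2 * M) ^+ 2.
  by rewrite ler_sqr ?nnegrE ?sqrtr_ge0 ?mulr_ge0 ?divr_ge0// ltW.
by rewrite sqr_sqrtr ?mulr_ge0//; nra.
Qed.
End Bound.
End MeanSquare.

(** * Shadows of convex bodies *)

Section Complex.
Context {R : realType}.
Implicit Types (z d : R[i]) (t : R).

Lemma inner_icis d t :
  inner d ('i * cis t) = complex.Im d * cos t + - complex.Re d * sin t.
Proof. by rewrite -complexiE /inner /cis; case: d => p q; simpc => /=; ring. Qed.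

Lemma normc_ge_Im d : `|complex.Im d|%:C <= `|d|.
Proof.
by case: d => x y; rewrite normc_def lecR/= -sqrtr_sqr ler_wsqrtr// lerDr sqr_ge0.
Qed.

Lemma continuous_coordinate (f : R[i] -> R) :
  {morph f : x y / x - y} -> (forall d, `|f d|%:C <= `|d|) ->
  continuous (f : R[i]^o -> R).
Proof.
move=> fB fle z.
have FF : Filter (nbhs (z : R[i]^o)) by exact: nbhs_filter.
apply/(@cvgrPdist_lt _ _ _ _ FF) => e e0.
have e0' : 0 < e%:C :> R[i] by rewrite ltcR.
apply/nbhs_ballP; exists e%:C => // y; rewrite -ball_normE /= => zy.
by rewrite -ltcR -fB; exact: le_lt_trans (fle _) zy.
Qed.

Lemma continuous_Re : continuous (fun z : R[i]^o => complex.Re z : R).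
Proof. by apply: continuous_coordinate => [x y|d]; [rewrite raddfB|exact: normc_ge_Re]. Qed.

Lemma continuous_Im : continuous (fun z : R[i]^o => complex.Im z : R).
Proof. by apply: continuous_coordinate => [x y|d]; [rewrite raddfB|exact: normc_ge_Im]. Qed.

Lemma continuous_real_complex : continuous (fun x : R => x%:C : R[i]^o).
Proof.
move=> x; apply/cvgrPdist_lt => -[e i] /=; rewrite ltcE/= => /andP[/eqP -> e0].
apply/nbhs_ballP; exists e => // y xy; rewrite -rmorphB normc_def/= expr0n addr0 sqrtr_sqr.
by rewrite ltcR; exact: xy.
Qed.

(** The norm of the complex plane takes complex values, so boundedness of a
    compact set is read on real-valued functions. *)
Lemma continuous_image_bounded (T : set R[i]) (f : R[i]^o -> R) :
  compact (T : set R[i]^o) -> continuous f ->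
  exists B, forall z, T z -> `|f z| <= B.
Proof.
move=> cT cf.
have /compact_bounded[M [_ MB]] : compact (f @` (T : set R[i]^o)).
  by apply: continuous_compact => //; exact: continuous_subspaceT.
by exists (M + 1) => z Tz; apply: (MB (M + 1)); [rewrite ltrDl|exists z].
Qed.

Lemma segment_left (a b : R[i]) : segment a b a.
Proof. by exists 0; [rewrite /= in_itv/= lexx ler01|rewrite subr0 mul1r mul0r addr0]. Qed.

Lemma segment_right (a b : R[i]) : segment a b b.
Proof. by exists 1; [rewrite /= in_itv/= lexx ler01|rewrite subrr mul1r mul0r add0r]. Qed.

Lemma two_gon_convex_body (a b : R[i]) : a != b -> nontrivial_convex_body (segment a b).
Proof.
move=> ab; split.
- have -> : segment a b =
      (fun t : R => (1 - t)%:C * a + t%:C * b : R[i]^o) @` `[0, 1]%classic by [].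
  apply: continuous_compact; last exact: segment_compact.
  apply: continuous_subspaceT => x.
  apply: cvgD; apply: cvgM; try exact: cvg_cst; last exact: continuous_real_complex.
  apply: continuous_comp; last exact: continuous_real_complex.
  by apply: cvgB; [exact: cvg_cst|exact: cvg_id].
- move=> x y l; rewrite !inE => -[s s01 <-] [t t01 <-].
  move: s01 t01; rewrite /= !in_itv/= => /andP[s0 s1] /andP[t0 t1].
  have l0 : 0 <= l%:num by []. have l1 : l%:num <= 1 by [].
  exists (l%:num * s + (1 - l%:num) * t).
    rewrite /= in_itv/=; apply/andP; split; nra.
  case: a b {ab} => [ax ay] [bx b'].
  by apply/eqP; rewrite eq_complex /= /unstable.onem; apply/andP; split; apply/eqP; ring.
- by exists a; exact: segment_left.
- move=> z E; have := segment_left a b; have := segment_right a b.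
  by rewrite E => /= bz az; rewrite az bz eqxx in ab.
Qed.

(** As a function of the angle, the inner product is itself a sinusoid. *)
Lemma inner_icis_sine_interpolation d (x y t : R) :
  sin (y - x) * inner d ('i * cis t) =
  sin (y - t) * inner d ('i * cis x) + sin (t - x) * inner d ('i * cis y).
Proof. by rewrite !inner_icis !sinB; ring. Qed.

Section Shadow.
Context (T : set R[i]) (B : R)
  (Re_le : forall z, T z -> `|complex.Re z| <= B)
  (Im_le : forall z, T z -> `|complex.Im z| <= B) (T_neq0 : T !=set0).

Lemma Re_diff_le z z' : T z -> T z' -> `|complex.Re (z - z')| <= B + B.
Proof.
by move=> Tz Tz'; rewrite raddfB (le_trans (ler_normB _ _))// lerD// Re_le.
Qed.

Lemma Im_diff_le z z' : T z -> T z' -> `|complex.Im (z - z')| <= B + B.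
Proof.
by move=> Tz Tz'; rewrite raddfB (le_trans (ler_normB _ _))// lerD// Im_le.
Qed.

Lemma inner_le_shadow z z' t : T z -> T z' ->
  inner (z - z') ('i * cis t) <= shadow T t.
Proof.
move=> Tz Tz'; apply: ub_le_sup; last by exists z => //; exists z'.
exists (B + B + (B + B)) => _ [u Tu [v Tv <-]]; rewrite inner_icis.
apply: le_trans (ler_norm _) _; apply: le_trans (ler_normD _ _) _.
rewrite !normrM normrN; apply: lerD.
  by apply: le_trans (Im_diff_le _ _ Tu Tv); rewrite ler_piMr ?cos_max.
by apply: le_trans (Re_diff_le _ _ Tu Tv); rewrite ler_piMr ?sin_max.
Qed.

Lemma shadow_le t c :
  (forall z z', T z -> T z' -> inner (z - z') ('i * cis t) <= c) -> shadow T t <= c.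
Proof.
move=> H; apply: ge_sup.
  by have [z Tz] := T_neq0; exists (inner (z - z) ('i * cis t)), z => //; exists z.
by move=> _ [u Tu [v Tv <-]]; exact: H.
Qed.

Lemma shadow_ge0 t : 0 <= shadow T t.
Proof.
have [z Tz] := T_neq0; apply: le_trans (inner_le_shadow z z t Tz Tz).
by rewrite subrr inner_icis /= oppr0 !mul0r addr0.
Qed.

(** Half a turn exchanges the roles of the two points in the supremum. *)
Lemma shadow_periodic : periodic (shadow T) pi.
Proof.
suff H t : shadow T (t + pi) <= shadow T t.
  move=> t; apply/le_anti; rewrite H/=.
  have -> : shadow T t = shadow T (t + pi *+ 2).
    rewrite /shadow; congr sup; congr image2; apply/funext => z; apply/funext => w.
    by rewrite !inner_icis cosD2pi sinD2pi.
  by rewrite mulr2n addrA.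
apply: shadow_le => z z' Tz Tz'; apply: le_trans (inner_le_shadow z' z t Tz' Tz).
by rewrite !inner_icis !raddfB cosDpi sinDpi /=; lra.
Qed.

(** A supremum of sinusoids. *)
Lemma shadow_sine_convex : sine_convex (shadow T).
Proof.
move=> x y t xt ty yx.
have sy : 0 <= sin (y - t) by apply: sin_ge0_pi; lra.
have sx : 0 <= sin (t - x) by apply: sin_ge0_pi; lra.
have : 0 <= sin (y - x) by apply: sin_ge0_pi; lra.
rewrite le_eqVlt => /predU1P[<-|s0].
  by rewrite mul0r addr_ge0// mulr_ge0// shadow_ge0.
rewrite mulrC -ler_pdivlMr//; apply: shadow_le => z z' Tz Tz'.
rewrite ler_pdivlMr// mulrC (inner_icis_sine_interpolation _ x y).
by apply: lerD; apply: ler_wpM2l => //; exact: inner_le_shadow.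
Qed.

(** The shadow is Lipschitz in the pair ([cos t], [sin t]), because the
    differences of points of [T] are bounded. *)
Lemma shadow_continuous : continuous (shadow T).
Proof.
have H s t : shadow T s <= shadow T t +
    (B + B) * (`|cos t - cos s| + `|sin t - sin s|).
  apply: shadow_le => z z' Tz Tz'.
  rewrite -lerBlDl; apply: le_trans (lerB (lexx _) (inner_le_shadow z z' t Tz Tz')) _.
  rewrite !inner_icis.
  set p := complex.Im _; set q := complex.Re _.
  have pB : `|p| <= B + B by exact: Im_diff_le.
  have qB : `|q| <= B + B by exact: Re_diff_le.
  rewrite (_ : _ - _ = p * (cos s - cos t) + q * (sin t - sin s)); last by ring.
  apply: le_trans (ler_norm _) _; apply: le_trans (ler_normD _ _) _.
  by rewrite !normrM mulrDr [`|cos s - _|]distrC lerD// ler_wpM2r.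
move=> s; apply/cvgrPdist_le => e e0.
have : (B + B) * (`|cos t - cos s| + `|sin t - sin s|) @[t --> s] --> (0 : R).
  have -> : 0 = (B + B) * (`|cos s - cos s| + `|sin s - sin s|).
    by rewrite !subrr normr0 addr0 mulr0.
  apply: cvgM; first exact: cvg_cst.
  by apply: cvgD; apply: cvg_norm; apply: cvgB; try exact: cvg_cst;
    [exact: continuous_cos|exact: continuous_sin].
move=> /cvgr_le /(_ _ e0); apply: filterS => t te.
rewrite ler_norml; apply/andP; split.
  by have := H t s; rewrite [`|cos s - _|]distrC [`|sin s - _|]distrC; lra.
by have := H s t; lra.
Qed.
End Shadow.

Lemma shadow_segment (a b : R[i]) t :
  shadow (segment a b) t = `|inner (b - a) ('i * cis t)|.
Proof.
have Sa := segment_left a b.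
have Sb := segment_right a b.
set v := inner _ _.
pose A := [set inner (z - w) ('i * cis t) | z in segment a b & w in segment a b].
have ub : ubound A `|v|.
  move=> _ [_ [r /= + <-] [_ [s /= + <-] <-]]; rewrite !in_itv/= => /andP[r0 r1] /andP[s0 s1].
  have -> : inner ((1 - r)%:C * a + r%:C * b - ((1 - s)%:C * a + s%:C * b)) ('i * cis t) =
      (r - s) * v.
    rewrite /v !inner_icis; case: a b {Sa Sb v A} => [ax ay] [bx b'] /=; ring.
  apply: le_trans (ler_norm _) _; rewrite normrM; apply: ler_piMl => //.
  by rewrite ler_norml; lra.
apply/le_anti/andP; split.
  apply: ge_sup ub; exists v; exists b => //; exists a => //.
have hub : has_ubound A by exists `|v|.
have [v0|v0] := ger0P v.
  by apply: ub_le_sup => //; exists b => //; exists a.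
apply: ub_le_sup => //; exists a => //; exists b => //.
by rewrite /v !inner_icis !raddfB /=; ring.
Qed.
End Complex.

(** * Deviation rates *)

Section Segment.
Context {R : realType}.

Lemma polar_form (p q : R) : exists a, forall x : R,
  p * cos x + q * sin x = Num.sqrt (p ^+ 2 + q ^+ 2) * sin (x + a).
Proof.
set r := Num.sqrt _.
have r2 : r ^+ 2 = p ^+ 2 + q ^+ 2 by rewrite sqr_sqrtr// addr_ge0// sqr_ge0.
have r0 : 0 <= r := sqrtr_ge0 _.
have [r00|rN0] := eqVneq r 0.
  exists 0 => x; move: r2; rewrite r00 expr0n/= mul0r => /esym/eqP.
  rewrite paddr_eq0 ?sqr_ge0// !sqrf_eq0 => /andP[/eqP-> /eqP->].
  by rewrite !mul0r addr0.
have rp : 0 < r by rewrite lt_def rN0.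
have qr : -1 <= q / r <= 1.
  rewrite -ler_norml normrM normfV (ger0_norm r0) ler_pdivrMr// mul1r.
  by rewrite -sqrtr_sqr /r ler_wsqrtr// lerDr sqr_ge0.
have [a [ca sa]] : exists a, cos a = q / r /\ sin a = p / r.
  have sq : Num.sqrt (1 - (q / r) ^+ 2) = `|p| / r.
    have -> : 1 - (q / r) ^+ 2 = (p / r) ^+ 2.
      by rewrite !expr_div_n r2; field; rewrite -r2 expf_neq0.
    by rewrite sqrtr_sqr normrM normfV (ger0_norm r0).
  have [p0|p0] := ger0P p.
    exists (acos (q / r)); rewrite sin_acos// sq ger0_norm// acosK//.
  exists (- acos (q / r)); rewrite cosN sinN sin_acos// sq ltr0_norm// acosK//.
  by rewrite mulNr opprK.
by exists a => x; rewrite sinD ca sa; field.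
Qed.

(** On the half-periods where [sin] has constant sign, an antiderivative of
    [`|sin|] differs from [cos] or [- cos] by a constant. *)
Lemma mean_abs_sin (r : R) : 0 <= r -> mean (fun x : R => `|r * sin x|) = 2 / pi * r.
Proof.
move=> r0.
have cf : continuous (fun x : R => `|r * sin x|).
  by move=> x; apply: cvg_norm; apply: cvgM; [exact: cvg_cst|exact: continuous_sin].
have [F dF] := antiderivative_exists _ (-1) cf.
rewrite (mean_antiderivative _ _ cf (fun=> normr_ge0 _) dF).
have pi0 := @pi_gt0 R.
have E1 : F 0 + r * cos 0 = F pi + r * cos pi.
  apply: (@eq_of_derive0 R (fun x => F x + r * cos x)); first exact: ltW.
  move=> x x0 xpi; have dFx : is_derive x 1 F (`|r * sin x|) by apply: dF; lra.
  have sx : 0 <= sin x by apply: sin_ge0_pi; rewrite x0.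
  apply: is_derive_eq; rewrite /GRing.scale/= ger0_norm ?mulr_ge0//; ring.
have E2 : F pi - r * cos pi = F (pi *+ 2) - r * cos (pi *+ 2).
  apply: (@eq_of_derive0 R (fun x => F x - r * cos x)); first by rewrite mulr2n; lra.
  rewrite mulr2n => x x0 xpi; have dFx : is_derive x 1 F (`|r * sin x|) by apply: dF; lra.
  have sx : sin x <= 0.
    rewrite -(subrK pi x) sinDpi oppr_le0; apply: sin_ge0_pi; lra.
  apply: is_derive_eq; rewrite /GRing.scale/= ler0_norm ?mulr_ge0_le0//; ring.
rewrite cos0 cospi cos2pi in E1 E2.
rewrite mulr_natl (_ : F (pi *+ 2) - F 0 = 4 * r); last by lra.
by clear -pi0; move: pi pi0 => P P0; field; rewrite gt_eqF.
Qed.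

Lemma mean_abs_trig (p q : R) :
  mean (fun x : R => `|p * cos x + q * sin x|) = 2 / pi * Num.sqrt (p ^+ 2 + q ^+ 2).
Proof.
have [a pq] := polar_form p q.
set r := Num.sqrt _; rewrite -(@mean_abs_sin r) ?sqrtr_ge0//.
rewrite -(mean_shift (fun x : R => `|r * sin x|) a).
- by congr mean; apply/funext => x; rewrite pq.
- by move=> x; apply: cvg_norm; apply: cvgM; [exact: cvg_cst|exact: continuous_sin].
- by move=> x; exact: normr_ge0.
- by move=> x; rewrite mulr_natl sinD2pi.
Qed.

(** The deviation rate is an increasing function of the ratio of [mean (X^2)] to
    [(mean X)^2]. *)
Lemma deviation_rate_le (X : R -> R) (c : R) : 0 < mean X ->
  mean (fun x => X x ^+ 2) <= c * mean X ^+ 2 -> deviation_rate X <= Num.sqrt (c - 1).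
Proof.
move=> M0 H; rewrite /deviation_rate ler_pdivrMr// -{2}(ger0_norm (ltW M0)) -sqrtr_sqr.
rewrite mulrC -sqrtrM ?sqr_ge0// ler_wsqrtr//; lra.
Qed.

Lemma deviation_rate_eq (X : R -> R) (c : R) : 0 < mean X ->
  mean (fun x => X x ^+ 2) = c * mean X ^+ 2 -> deviation_rate X = Num.sqrt (c - 1).
Proof.
move=> M0 H; rewrite /deviation_rate H.
rewrite (_ : _ - _ = mean X ^+ 2 * (c - 1)); last by ring.
rewrite sqrtrM ?sqr_ge0//.
by rewrite sqrtr_sqr ger0_norm ?ltW// mulrAC divff ?mul1r// gt_eqF.
Qed.

Lemma sqr_Im_Re_gt0 (d : R[i]) : d != 0 ->
  0 < complex.Im d ^+ 2 + (- complex.Re d) ^+ 2.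
Proof.
case: d => x y; rewrite eq_complex/= => d0; rewrite sqrrN.
rewrite lt_def addr_ge0 ?sqr_ge0// andbT paddr_eq0 ?sqr_ge0// !sqrf_eq0.
by rewrite andbC.
Qed.

Lemma deviation_rate_two_gon (a b : R[i]) : a != b ->
  deviation_rate (shadow (segment a b)) = Num.sqrt (pi ^+ 2 / 8 - 1).
Proof.
move=> ab; set p := complex.Im (b - a); set q := - complex.Re (b - a).
have sE : shadow (segment a b) = fun t => `|p * cos t + q * sin t|.
  by apply/funext => t; rewrite shadow_segment inner_icis.
have r0 : 0 < p ^+ 2 + q ^+ 2 by apply: sqr_Im_Re_gt0; rewrite subr_eq0 eq_sym.
have pi0 := @pi_gt0 R.
apply: deviation_rate_eq; rewrite sE mean_abs_trig.
  by rewrite !mulr_gt0 ?invr_gt0 ?sqrtr_gt0.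
under eq_fun do rewrite real_normK ?num_real//.
rewrite mean_sqr_trig exprMn sqr_sqrtr ?ltW//.
by move: (pi : R) pi0 => P P0; field; rewrite gt_eqF.
Qed.
End Segment.

Theorem theorem2 (R : realType) (U : set R[i]) (hU : is_two_gon U) :
  nontrivial_convex_body U /\
  forall T : set R[i], nontrivial_convex_body T ->
    deviation_rate (shadow T) <= deviation_rate (shadow U).
Proof.
have [a [b [ab ->]]] := hU; split; first exact: two_gon_convex_body.
move=> T [cT _ [z0 Tz0] T1]; rewrite deviation_rate_two_gon//.
have [B [ReB ImB]] : exists B : R, (forall z, T z -> `|complex.Re z| <= B) /\
    (forall z, T z -> `|complex.Im z| <= B).
  have [B1 H1] := continuous_image_bounded T _ cT continuous_Re.
  have [B2 H2] := continuous_image_bounded T _ cT continuous_Im.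
  exists (Num.max B1 B2); split=> z Tz; rewrite le_max.
    by rewrite H1.
  by rewrite H2// orbT.
have T0 : T !=set0 by exists z0.
have cw : continuous (shadow T) by exact: shadow_continuous ReB ImB T0.
have w0 : forall t, 0 <= shadow T t by exact: shadow_ge0 ReB ImB T0.
have H := mean_sqr_le _ cw w0 (shadow_periodic T _ ReB ImB T0)
  (shadow_sine_convex T _ ReB ImB T0).
apply: deviation_rate_le => //.
have [z1 Tz1 z01] : exists2 z1, T z1 & z1 != z0.
  apply: contrapT => N; apply: (T1 z0); apply/seteqP; split => [z Tz|_ ->//].
  by apply/eqP/negPn/negP => zz0; apply: N; exists z.
(* If the mean shadow vanished, so would the mean square shadow, which is at
   least that of the segment from [z0] to [z1]. *)
rewrite lt_def mean_ge0// andbT; apply/eqP => M0.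
set p := complex.Im (z1 - z0); set q := - complex.Re (z1 - z0).
have r0 : 0 < p ^+ 2 + q ^+ 2 by apply: sqr_Im_Re_gt0; rewrite subr_eq0.
have : mean (fun t => (p * cos t + q * sin t) ^+ 2) <= mean (fun t => shadow T t ^+ 2).
  apply: mean_le.
  - by apply: continuous_sqr; exact: continuous_trig.
  - exact: continuous_sqr.
  - by move=> t; exact: sqr_ge0.
  - move=> t; rewrite /p /q -inner_icis -[leLHS]real_normK ?num_real// ler_sqr ?nnegrE//.
    rewrite ler_norml lerNl; apply/andP; split; last first.
      exact: inner_le_shadow ReB ImB _ _ _ Tz1 Tz0.
    apply: le_trans (inner_le_shadow _ _ ReB ImB _ _ t Tz0 Tz1).
    by rewrite !inner_icis !raddfB /=; lra.
rewrite mean_sqr_trig; move: H; rewrite M0 expr0n/= mulr0; lra.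
Qed.
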